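(* A graph $G$ is bad if and only if it is non-Pfaffian.
   Context: Graphs are finite and simple. For a graph $G$ with a $1$-factor $F$: a cycle $C$ is $F$-alternating if $|E(C)|=2|E(F)\cap E(C)|$; in an orientation of $G$ an even cycle $C$ is evenly (resp. oddly) oriented if, for either direction of traversal, the number of edges of $C$ directed along the traversal is even (resp. odd); an orientation is an odd $F$-orientation if every $F$-alternating cycle is oddly oriented. $G$ is Pfaffian if it has an orientation which is an odd $F$-orientation for every $1$-factor $F$ of $G$ (equivalently, when $G$ has a $1$-factor, an orientation which is an odd $F$-orientation for some $1$-factor $F$). A zero-sum $F$-set is a finite family $\{C_1,\ldots,C_k\}$ of $F$-alternating cycles such that every edge of $G$ lies in an even number of its members. $G$ is bad if it has a $1$-factor $F$ such that $G$ has a zero-sum $F$-set $\mathcal{A}$ and an orientation in which exactly an odd number of members of $\mathcal{A}$ are evenly oriented and all other members of $\mathcal{A}$ are oddly oriented. *)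

(* Defs.v *)
From mathcomp Require Import all_boot.

Set Implicit Arguments.
Unset Strict Implicit.
Unset Printing Implicit Defensive.

(* A finite simple graph is a symmetric irreflexive relation e on a finType.
   Edges are two-element vertex sets, and subgraphs without isolated vertices
   (1-factors, cycles) are identified with their edge sets. *)

Section Graph.

Variables (T : finType) (e : rel T).

Definition edges : {set {set T}} :=
  [set [set x; y] | x in T, y in T & e x y].

Definition one_factor (F : {set {set T}}) : bool :=
  (F \subset edges) && [forall x, #|[set f in F | x \in f]| == 1].

Definition traversal_edges (s : seq T) : {set {set T}} :=
  [set [set x; next s x] | x in s].

(* The vertex sequence s, read cyclically, is a traversal of the cycle with
   edge set C, with some starting vertex and in some direction. *)
Definition traverses (s : seq T) (C : {set {set T}}) : bool :=
  [&& 2 < size s, ucycleb e s & traversal_edges s == C].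

(* A traversal has as many vertices as the cycle has edges, so quantifying
   over tuples of length #|C| covers all traversals of C. *)
Definition is_cycle (C : {set {set T}}) : bool :=
  [exists s : #|C|.-tuple T, traverses s C].

Definition alternating (F C : {set {set T}}) : bool :=
  is_cycle C && (#|C| == 2 * #|F :&: C|).

(* D x y means that the edge xy is directed from x to y. *)
Definition orientation (D : rel T) : Prop :=
  (forall x y, D x y -> e x y) /\ (forall x y, e x y -> D x y (+) D y x).

Definition forward_count (D : rel T) (s : seq T) : nat :=
  count (fun x => D x (next s x)) s.

Definition evenly_oriented (D : rel T) (C : {set {set T}}) : bool :=
  [&& is_cycle C, ~~ odd #|C| &
      [forall s : #|C|.-tuple T, traverses s C ==> ~~ odd (forward_count D s)]].

Definition oddly_oriented (D : rel T) (C : {set {set T}}) : bool :=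
  [&& is_cycle C, ~~ odd #|C| &
      [forall s : #|C|.-tuple T, traverses s C ==> odd (forward_count D s)]].

Definition odd_orientation (F : {set {set T}}) (D : rel T) : Prop :=
  orientation D /\ forall C, alternating F C -> oddly_oriented D C.

Definition pfaffian : Prop :=
  exists D : rel T, orientation D /\
    forall F, one_factor F -> odd_orientation F D.

(* Cancelling repeated cycles in pairs preserves both the zero-sum condition
   and the parity in bad, so nothing is lost by taking a set of cycles
   instead of a family with repetitions. *)
Definition zero_sum (F : {set {set T}}) (A : {set {set {set T}}}) : Prop :=
  (forall C, C \in A -> alternating F C) /\
  (forall f, f \in edges -> ~~ odd #|[set C in A | f \in C]|).

Definition bad : Prop :=
  exists (F : {set {set T}}) (A : {set {set {set T}}}) (D : rel T),
    [/\ one_factor F, zero_sum F A, orientation D,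
        odd #|[set C in A | evenly_oriented D C]| &
        forall C, C \in A -> ~~ evenly_oriented D C -> oddly_oriented D C].

End Graph.

(* Main.v *)
Require Import Defs.
From mathcomp Require Import all_boot all_fingroup all_algebra.

(* Fix a 1-factor F and a reference orientation.  Reversing a set Z of edges
   changes the parity of a cycle C by |Z :&: C|, so the odd F-orientations are
   the solutions Z of a linear system over F_2 indexed by the F-alternating
   cycles, and an inconsistency of this system is precisely a zero-sum F-set
   with an odd number of evenly oriented members.  It remains to see that an
   odd F-orientation is an odd F'-orientation for every 1-factor F'.  This uses
   the signs of the terms of the Pfaffian: exchanging the two halves of an
   alternating cycle preserves the sign if and only if the cycle is oddly
   oriented, so an odd F-orientation gives all 1-factors the sign of F. *)

Set Implicit Arguments.
Unset Strict Implicit.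
Unset Printing Implicit Defensive.

(** * Parities of cardinalities as exclusive ors *)

Lemma odd_card_xor (I : finType) (P : {pred I}) :
  odd #|P| = \big[addb/false]_i (i \in P).
Proof.
rewrite -sum1_card big_mkcond (big_morph odd oddD (erefl : odd 0 = false)).
by apply: eq_bigr => i _; case: (i \in P).
Qed.

Lemma odd_card_set_xor (I : finType) (A : {pred I}) (P : pred I) :
  odd #|[set i in A | P i]| = \big[addb/false]_(i in A) P i.
Proof.
rewrite odd_card_xor [RHS]big_mkcond; apply: eq_bigr => i _.
by rewrite inE; case: (i \in A).
Qed.

(** * Duality for linear systems over F_2 *)

Section F2.
Import GRing.Theory.
Local Open Scope ring_scope.

Lemma natr_F2_eq0 n : (n%:R == 0 :> 'F_2) = ~~ odd n.
Proof. by rewrite -(dvdn_pcharf (pchar_Fp (isT : prime 2))) dvdn2. Qed.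

Lemma F2_nat (x : 'F_2) : x = (x != 0)%:R.
Proof. by case: x => [[|[|//]]] i; apply: val_inj. Qed.

Lemma sum_F2 (I : finType) (u v : I -> bool) :
  \sum_i (u i)%:R * (v i)%:R = #|[set i | u i & v i]|%:R :> 'F_2.
Proof.
rewrite -sum1_card natr_sum [RHS]big_mkcond; apply: eq_bigr => i _.
by rewrite inE -natrM mulnb; case: (_ && _).
Qed.

(** Linear duality: either the row [b] lies in the row space of [M], or some column of the cokernel
    of [M], orthogonal to all rows of [M], has nonzero product with [b]. Supports of vectors over
    F_2 serve as the sets [Z] and [A]. *)
Lemma F2_alternative (I J : finType) (M : I -> J -> bool) (b : J -> bool) :
  (exists Z : {set I}, forall j, odd #|[set i in Z | M i j]| = b j) \/
  (exists A : {set J}, (forall i, ~~ odd #|[set j in A | M i j]|) /\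
     odd #|[set j in A | b j]|).
Proof.
pose N : 'M['F_2]_(#|I|, #|J|) :=
  \matrix_(i, j) (M (enum_val i) (enum_val j))%:R.
pose v : 'rV['F_2]_#|J| := \row_j (b (enum_val j))%:R.
have [/submxP[z vE]|] := boolP (v <= N)%MS.
  left; exists [set i | z 0 (enum_rank i) != 0] => j.
  move/matrixP: vE => /(_ 0 (enum_rank j)); rewrite !mxE enum_rankK => vE.
  have /eqP : (b j)%:R
      == (#|[set i | z 0 (enum_rank i) != 0 & M i j]|)%:R :> 'F_2.
    rewrite vE -sum_F2 (reindex (@enum_rank I)) /=; last first.
      by apply: onW_bij; apply: enum_rank_bij.
    by apply/eqP/eq_bigr => i _; rewrite mxE !enum_rankK -F2_nat.
  move/(congr1 (fun x => x != 0)); rewrite !natr_F2_eq0 !negbK oddb => ->.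
  by congr (odd #|pred_of_set _|); apply/setP => i; rewrite !inE.
rewrite submxE => /rV0Pn [k vk]; right.
pose y j := cokermx N (enum_rank j) k.
exists [set j | y j != 0]; split => [i|].
  have /matrixP/(_ (enum_rank i) k) := mulmx_coker N; rewrite !mxE => /eqP.
  rewrite (reindex (@enum_rank J)) /=; last first.
    by apply: onW_bij; apply: enum_rank_bij.
  under eq_bigr => j _ do
    rewrite mxE !enum_rankK (F2_nat (cokermx _ _ _)) mulrC.
  rewrite sum_F2 natr_F2_eq0.
  by congr (~~ odd #|pred_of_set _|); apply/setP => j; rewrite !inE.
move: vk; rewrite !mxE (reindex (@enum_rank J)) /=; last first.
  by apply: onW_bij; apply: enum_rank_bij.
under eq_bigr => j _ do
  rewrite mxE !enum_rankK (F2_nat (cokermx _ _ _)) mulrC.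
rewrite sum_F2 natr_F2_eq0 negbK.
by congr (odd #|pred_of_set _|); apply/setP => j; rewrite !inE.
Qed.

End F2.

(** * Edges, traversals and the parity of an oriented cycle *)

Lemma set2_eq (T : finType) (x y u v : T) :
  [set x; y] = [set u; v] -> (x = u /\ y = v) \/ (x = v /\ y = u).
Proof.
move=> E; have := set21 x y; have := set22 x y; have := set21 u v.
have := set22 u v; rewrite E -{1 2}E !inE.
do 4![case/orP => /eqP ?]; subst; by [left | right].
Qed.

Section Traversals.
Variables (T : finType) (e : rel T).
Hypotheses (e_sym : symmetric e) (e_irr : irreflexive e).
Implicit Types (s : seq T) (C F Z : {set {set T}}) (D : rel T).

Lemma next_next_neq s x : uniq s -> 2 < size s -> x \in s ->
  next s (next s x) != x.
Proof.
move=> Us s2 xs; have [i s' E] := rot_to xs.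
rewrite -!(next_rot i Us) E.
have: uniq (x :: s') by rewrite -E rot_uniq.
have: 2 < size (x :: s') by rewrite -E size_rot.
case: s' {E} => [|y [|z r]] //= _; rewrite !inE !negb_or.
case/and4P=> /and3P[xy xz _] /andP[yz _] _ _.
by rewrite !eqxx (eq_sym y) (negbTE xy) eq_sym.
Qed.

(** If distinct [x] and [y] gave the same edge, [next s] would exchange them, which needs a cycle of
    length 2. Injectivity turns sums over the edges of a cycle into sums over its vertices. *)
Lemma next_edge_inj s : uniq s -> 2 < size s ->
  {in s &, injective (fun x => [set x; next s x])}.
Proof.
move=> Us s2 x y xs ys /set2_eq[[]//|[xE nE]].
by have := next_next_neq Us s2 ys; rewrite -xE nE eqxx.
Qed.

Section Fixed.
Variables (s : seq T) (C : {set {set T}}).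
Hypothesis tr : traverses e s C.

Lemma trav_size : 2 < size s. Proof. by case/and3P: tr. Qed.
Lemma trav_uniq : uniq s. Proof. by case/and3P: tr => _ /andP[]. Qed.
Lemma trav_edge x : x \in s -> e x (next s x).
Proof. by case/and3P: tr => _ /andP[c _] _; apply: next_cycle. Qed.
Lemma trav_edges : C = traversal_edges s.
Proof. by case/and3P: tr => _ _ /eqP. Qed.

Lemma trav_xor (P : pred {set T}) :
  \big[addb/false]_(c in C) P c
  = \big[addb/false]_(x in s) P [set x; next s x].
Proof.
rewrite trav_edges big_imset //; exact: next_edge_inj trav_uniq trav_size.
Qed.

Lemma trav_card : #|C| = size s.
Proof.
rewrite trav_edges card_in_imset; last first.
  exact: next_edge_inj trav_uniq trav_size.
exact/card_uniqP/trav_uniq.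
Qed.

Lemma trav_is_cycle : is_cycle e C.
Proof.
apply/existsP; exists (tcast (esym trav_card) (in_tuple s)).
by rewrite val_tcast.
Qed.

Lemma trav_cover x : (x \in s) = (x \in cover C).
Proof.
apply/idP/bigcupP => [xs|[c]]; rewrite trav_edges.
  by exists [set x; next s x]; [apply: imset_f | rewrite set21].
case/imsetP=> y ys ->; rewrite !inE => /orP[]/eqP-> //.
by rewrite mem_next.
Qed.

Lemma odd_forward D :
  odd (forward_count D s) = \big[addb/false]_(x in s) D x (next s x).
Proof.
rewrite /forward_count -sum1_count (big_morph odd oddD (erefl : odd 0 = false)).
rewrite big_mkcond big_uniq ?trav_uniq //.
by apply: eq_bigr => x _; case: D.
Qed.
End Fixed.

Lemma orientation_flip D x y : orientation e D -> e x y -> D x y = ~~ D y x.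
Proof. by case=> _ H xy; move: (H _ _ xy); case: (D x y); case: (D y x). Qed.

Lemma forward_diff s C D D' Z :
  (forall x y, e x y -> D x y (+) D' x y = ([set x; y] \in Z)) ->
  traverses e s C ->
  odd (forward_count D s) (+) odd (forward_count D' s)
  = odd #|[set f in Z | f \in C]|.
Proof.
move=> H tr; rewrite !(odd_forward tr) -big_split /=.
have -> : [set f in Z | f \in C] = [set f in C | f \in Z].
  by apply/setP => f; rewrite !inE andbC.
rewrite odd_card_set_xor (trav_xor tr).
by apply: eq_bigr => x xs; apply/H/(trav_edge tr).
Qed.

Lemma odd_index_next s x : uniq s -> ~~ odd (size s) -> x \in s ->
  odd (index (next s x) s) = ~~ odd (index x s).
Proof.
case: s => [|y p] // Us ev xs; rewrite next_nth xs.
have: index x (y :: p) < (size p).+1 by rewrite -index_mem in xs.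
rewrite ltnS leq_eqVlt => /orP[/eqP E|lt].
  (* At the last vertex [nth] returns its default [y], the head, of index 0; the last index is odd
     because the length is even. *)
  rewrite E nth_default //= eqxx; move: ev; rewrite /= negbK => ->.
  by [].
by rewrite -[nth y p _]/(nth y (y :: p) (index x (y :: p)).+1) index_uniq.
Qed.

(* A cycle of even length is bipartite.  If all its edges were directed towards
   the same colour class, the number of forward edges in any traversal would be
   the size of a colour class; each edge directed the other way changes the
   parity. *)
Lemma forward_parity s s' C D : orientation e D -> ~~ odd #|C| ->
  traverses e s C -> traverses e s' C ->
  odd (forward_count D s) = odd (forward_count D s').
Proof.
move=> oD ev tr tr'.
pose col x := odd (index x s).
(* For an edge [c] of the cycle, [d c] means that [c] points from the even indices to the odd ones;
   this does not depend on the traversal being counted. *)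
pose d c := [exists x, exists y, [&& c == [set x; y], ~~ col x & D x y]].
have colC x y : [set x; y] \in C -> col y = ~~ col x.
  rewrite (trav_edges tr) => /imsetP[z zs].
  have nz : col (next s z) = ~~ col z.
    by apply: odd_index_next; rewrite ?(trav_uniq tr) // -(trav_card tr).
  by case/set2_eq => [] [-> ->]; rewrite nz ?negbK.
have main r : traverses e r C -> odd (forward_count D r)
    = (\big[addb/false]_(c in C) d c) (+) \big[addb/false]_(x in cover C) col x.
  move=> trr; rewrite (odd_forward trr) (trav_xor trr).
  under [X in _ (+) X]eq_bigl => x do rewrite -(trav_cover trr).
  rewrite -big_split /=; apply: eq_bigr => x xr.
  have exn := trav_edge trr xr.
  have /colC cn : [set x; next r x] \in C.
    by rewrite (trav_edges trr); apply: imset_f.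
  have -> : d [set x; next r x]
      = if col x then D (next r x) x else D x (next r x).
    apply/existsP/idP => [[u /existsP[v /and3P[/eqP/set2_eq[][<- <-]]]]|].
    - by move/negbTE->.
    - by rewrite cn negbK => ->.
    case: ifP => cx Dx.
      by exists (next r x); apply/existsP; exists x; rewrite setUC eqxx cn cx.
    by exists x; apply/existsP; exists (next r x); rewrite eqxx cx.
  by rewrite (orientation_flip oD exn); case: (col x); case: (D (next r x) x).
by rewrite (main _ tr) (main _ tr').
Qed.

Lemma oddly_orientedE s C D : orientation e D -> ~~ odd #|C| ->
  traverses e s C -> oddly_oriented e D C = odd (forward_count D s).
Proof.
move=> oD ev tr; rewrite /oddly_oriented (trav_is_cycle tr) ev /=.
apply/forallP/idP => [/(_ (tcast (esym (trav_card tr)) (in_tuple s)))|o r].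
  by rewrite val_tcast tr.
by apply/implyP => /(forward_parity oD ev tr) <-.
Qed.

Lemma evenly_orientedE s C D : orientation e D -> ~~ odd #|C| ->
  traverses e s C -> evenly_oriented e D C = ~~ odd (forward_count D s).
Proof.
move=> oD ev tr; rewrite /evenly_oriented (trav_is_cycle tr) ev /=.
apply/forallP/idP => [/(_ (tcast (esym (trav_card tr)) (in_tuple s)))|o r].
  by rewrite val_tcast tr.
by apply/implyP => /(forward_parity oD ev tr) <-.
Qed.

Lemma alternating_even F C : alternating e F C ->
  ~~ odd #|C| /\ exists s, traverses e s C.
Proof.
case/andP=> /existsP[s tr] /eqP ->; rewrite oddM; split=> //.
by exists s.
Qed.

Lemma parity_oriented D C F : orientation e D -> alternating e F C ->
  oddly_oriented e D C = ~~ evenly_oriented e D C.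
Proof.
move=> oD /alternating_even[ev [s tr]].
by rewrite (oddly_orientedE oD ev tr) (evenly_orientedE oD ev tr) negbK.
Qed.

Lemma oriented_diff D D' Z C F :
  (forall x y, e x y -> D x y (+) D' x y = ([set x; y] \in Z)) ->
  orientation e D -> orientation e D' -> alternating e F C ->
  evenly_oriented e D C (+) evenly_oriented e D' C
  = odd #|[set f in Z | f \in C]|.
Proof.
move=> H oD oD' /alternating_even[ev [s tr]].
rewrite -(forward_diff H tr) (evenly_orientedE oD ev tr).
by rewrite (evenly_orientedE oD' ev tr) addbN addNb negbK.
Qed.

End Traversals.

(** * Relative signs of 1-factors *)

Section Sign.
Variables (T : finType) (D : rel T).
Implicit Types (f : T -> T) (p q : {perm T}) (s : seq T).

Definition oriented_along f := forall x, D (f x) x = ~~ D x (f x).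

(* When f and f' are the mate functions of two 1-factors, p carries the edges
   of the first one to those of the second one, tails to tails.  The parity of
   such a p is the quotient of the signs of the two corresponding terms of the
   Pfaffian. *)
Definition carries f f' p :=
  (forall x, p (f x) = f' (p x)) /\
  (forall x, D x (f x) = D (p x) (f' (p x))).

Lemma carriesM f1 f2 f3 p q :
  carries f1 f2 p -> carries f2 f3 q -> carries f1 f3 (p * q)%g.
Proof.
case=> [p1 p2] [q1 q2]; split=> x; rewrite !permM; first by rewrite p1 q1.
by rewrite p2 q2.
Qed.

Lemma carriesV f1 f2 p : carries f1 f2 p -> carries f2 f1 p^-1%g.
Proof.
case=> [p1 p2]; split=> x; rewrite -[x](permKV p); move: ((p^-1)%g x) => y.
  by rewrite -p1 !permK.
by rewrite permK -p2.
Qed.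

(* Such a p acts in the same way on the tails and on the heads. *)
Lemma carries_even f p : involutive f -> oriented_along f ->
  carries f f p -> odd_perm p = false.
Proof.
move=> fK fD [p1 p2].
pose A := [set x | D x (f x)].
have pA x : (p x \in A) = (x \in A) by rewrite !inE -p2.
have fA x : (f x \in A) = (x \notin A) by rewrite !inE fK fD.
have NA : p \in ('N(A | 'P))%g.
  by apply/astabsP => x; apply: pA.
(* [r] is the part of [p] on the tails; its conjugate by the mate involution [h] is the part on the
   heads and has the same parity. *)
pose r := restr_perm A p; pose h := perm (inv_inj fK).
have rA x : x \in A -> r x = p x by apply: restr_permE.
have rN x : x \notin A -> r x = x by apply: out_perm; apply: restr_perm_on.
have rJ x : (r ^ h)%g x = f (r (f x)).
  by rewrite -{1}[x]fK -{1}(permE (inv_inj fK) (f x)) permJ permE.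
suff -> : p = (r * r ^ h)%g by rewrite odd_permM odd_permJ addbb.
apply/permP => x; rewrite permM rJ; have [xA | xA] := boolP (x \in A).
  by rewrite (rA x) // (rN (f (p x))) ?fK // fA negbK pA.
by rewrite (rN x) // (rA (f x)) ?fA // p1 fK.
Qed.

Lemma carries_parity f f' p q : involutive f -> oriented_along f ->
  carries f f' p -> carries f f' q -> odd_perm p = odd_perm q.
Proof.
move=> fK fD cp /carriesV cq.
have := carries_even fK fD (carriesM cp cq).
by rewrite odd_permM odd_permV; case: (odd_perm p); case: (odd_perm q).
Qed.

(* Each edge that p carries to an edge of the opposite direction is repaired
   by swapping its two ends. *)
Lemma carries_repair f f' p : involutive f -> oriented_along f ->
  oriented_along f' -> (forall x, p (f x) = f' (p x)) ->
  exists2 q, carries f f' q & odd_perm q =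
    odd_perm p (+) odd #|[set x | D x (f x) && ~~ D (p x) (f' (p x))]|.
Proof.
move=> fK fD f'D; move En: #|_| => n; elim: n p En => [|n IHn] p En pf.
  exists p; rewrite ?addbF //; split=> // x.
  (* Emptiness at [x] forbids sending a tail to a head; emptiness at [f x] forbids the converse. *)
  move/cards0_eq/setP: En => E; have := E x; have := E (f x).
  rewrite !inE fK fD pf -(f'D (p x)) -pf.
  have f'p : f' (p (f x)) = p x by rewrite -pf fK.
  rewrite f'p pf f'D.
  by case: (D x (f x)); case: (D (p x) (f' (p x))).
have [x] : exists x, x \in [set x | D x (f x) && ~~ D (p x) (f' (p x))].
  by apply/set0Pn; rewrite -card_gt0 En.
rewrite inE => /andP[xD pxD].
have xfx : x != f x by apply/eqP => E; have := fD x; rewrite -E; case: (D x x).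
have tf y : tperm x (f x) (f y) = f (tperm x (f x) y).
  have [->|yx] := eqVneq y x; first by rewrite tpermL tpermR fK.
  have [->|yfx] := eqVneq y (f x); first by rewrite tpermR fK tpermL.
  rewrite !tpermD // eq_sym ?(inj_eq (inv_inj fK)) //.
  by apply: contra yfx => /eqP<-; rewrite fK.
(* Swapping [x] and [f x] first corrects this edge and leaves all the others as they were. *)
have Eq : [set y | D y (f y) &&
      ~~ D ((tperm x (f x) * p)%g y) (f' ((tperm x (f x) * p)%g y))]
    = [set y | D y (f y) && ~~ D (p y) (f' (p y))] :\ x.
  apply/setP => y; rewrite !inE permM.
  have [->|yx] /= := eqVneq y x; last have [->|yfx] := eqVneq y (f x).
  - have f'p : f' (p (f x)) = p x by rewrite -pf fK.
    by rewrite tpermL f'p pf f'D pxD andbF.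
  - by rewrite fK fD xD.
  by rewrite tpermD // eq_sym.
have [||q cq qo] := IHn (tperm x (f x) * p)%g.
- rewrite Eq; move: En; rewrite (cardsD1 x) inE xD pxD /= => -[<-].
  by apply: eq_card => y; rewrite !inE.
- by move=> y; rewrite !permM tf pf.
exists q; rewrite // qo odd_permM odd_tperm xfx /=.
by case: (odd_perm p); case: (odd n).
Qed.

(** * Rotation of an alternating cycle *)

Section Next.
Variables (s : seq T) (Us : uniq s).

Definition next_perm := perm (can_inj (prev_next Us)).

Lemma next_out x : x \notin s -> next s x = x.
Proof. by rewrite next_nth => /negbTE->. Qed.

(** The orbits are [s] and the singletons outside it, so their number is [#|T|] minus [size s] plus
    1. *)
Lemma odd_next_perm : s != [::] -> odd_perm next_perm = ~~ odd (size s).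
Proof.
move=> s0; have [x0 x0s] : exists x0, x0 \in s.
  by case: (s) s0 => // x0 ?; exists x0; rewrite mem_head.
pose S := [set z in s]; pose np := next_perm.
have npX i x : (np ^+ i)%g x = iter i (next s) x.
  by rewrite permX; elim: i => //= i ->; rewrite permE.
have pS x : x \in S -> porbit np x = S.
  rewrite inE => xs; apply/setP => z.
  rewrite inE -(fconnect_cycle (cycle_next Us) xs).
  apply/porbitP/idP => [[i ->]|/iter_findex <-].
    by rewrite npX fconnect_iter.
  by eexists; rewrite npX.
have pN x : x \notin S -> porbit np x = [set x].
  rewrite inE => xs; apply/setP => z; rewrite inE.
  apply/porbitP/eqP => [[i ->]|->]; last by exists 0; rewrite npX.
  by rewrite npX; elim: i => //= i ->; apply: next_out.
have x0S : x0 \in S by rewrite inE.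
have E : porbits np = S |: [set [set z] | z in ~: S].
  apply/setP => B; rewrite !inE; apply/imsetP/idP => [[x _ ->]|].
    have [xS|xS] := boolP (x \in S); first by rewrite pS ?eqxx.
    by rewrite pN // imset_f ?orbT // inE.
  case/orP => [/eqP->|/imsetP[z]]; first by exists x0; rewrite // pS.
  by rewrite inE => zS ->; exists z; rewrite // pN.
have nS : S \notin [set [set z] | z in ~: S].
  by apply/imsetP => -[z]; rewrite inE => zS E'; rewrite E' set11 in zS.
have cS : #|S| = size s by rewrite cardsE; apply/card_uniqP.
rewrite -/np /odd_perm E cardsU1 nS card_imset; last exact: set1_inj.
rewrite -(cardsC S) cS !oddD.
by case: (odd (size _)); case: (odd _).
Qed.

Lemma big_next (G : T -> bool) :
  \big[addb/false]_(x in s) G (next s x) = \big[addb/false]_(x in s) G x.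
Proof.
rewrite [RHS](reindex_inj (can_inj (prev_next Us))).
by apply: eq_bigl => x; rewrite mem_next.
Qed.

Variable a : pred T.
Hypothesis a_next : {in s, forall x, a (next s x) = ~~ a x}.

(** By alternation the vertices of [s] split into pairs [x], [next s x] with [a x]. *)
Lemma xor_pairs (G : T -> bool) :
  \big[addb/false]_(x in s) G x
  = \big[addb/false]_(x in s) (a x && (G x (+) G (next s x))).
Proof.
transitivity (\big[addb/false]_(x in s)
    ((a x && G x) (+) (~~ a x && G x))).
  by apply: eq_bigr => x _; case: (a x); rewrite ?addbF.
rewrite big_split /= -[X in _ (+) X]big_next -big_split /=.
by apply: eq_bigr => x xs; rewrite a_next // negbK; case: (a x).
Qed.

Lemma alt_even_size : ~~ odd (size s).
Proof.
rewrite -(card_uniqP Us) odd_card_xor.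
have -> : \big[addb/false]_i (i \in s) = \big[addb/false]_(i in s) true.
  by rewrite [RHS]big_mkcond; apply: eq_bigr => i _; case: (i \in s).
by rewrite xor_pairs big1 // => x _; rewrite andbF.
Qed.

Variables f f' : T -> T.
Hypotheses (fK : involutive f) (f'K : involutive f').
Hypotheses (fD : oriented_along f) (f'D : oriented_along f').
Hypothesis next_alt : {in s, forall x, next s x = if a x then f x else f' x}.
Hypothesis off_s : forall x, x \notin s -> f x = f' x.

(** Whichever of [f] and [f'] does not lead forward from [x] led forward into [x] from its
    predecessor, and it is an involution. *)
Lemma mate_prev x : x \in s ->
  (if a x then f' x else f x) = prev s x.
Proof.
move=> xs; have ys : prev s x \in s by rewrite mem_prev.
have := next_alt ys; have := a_next ys; rewrite next_prev // => ->.
by move: (prev s x) => y; case: (a y) => /= ->; rewrite ?fK ?f'K.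
Qed.

Lemma next_altE : 2 < size s -> {in s, forall x, (next s x == f x) = a x}.
Proof.
move=> s2 x xs; have := mate_prev xs; have := next_alt xs.
case: (a x) => nE fE; first by rewrite nE eqxx.
have pxs : prev s x \in s by rewrite mem_prev.
by have := next_next_neq Us s2 pxs; rewrite next_prev // fE => /negbTE.
Qed.

(* Rotating the cycle s by one step carries f to f' up to the direction of the
   edges, and a rotation of a cycle of even length is odd. *)
Lemma carries_rotation : s != [::] ->
  exists2 q, carries f f' q
           & odd_perm q = ~~ (\big[addb/false]_(x in s) D x (next s x)).
Proof.
move=> s0; have [|q cq qo] := @carries_repair f f' next_perm fK fD f'D.
  move=> x; rewrite !permE; have [xs|xs] := boolP (x \in s); last first.
    suff fxs : f x \notin s by rewrite !next_out // off_s.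
    apply: contra xs => fxs; have := mate_prev fxs; have := next_alt fxs.
    rewrite fK; case: (a _) => [<-|_ E]; first by rewrite mem_next.
    by rewrite E mem_prev.
  have nxs : next s x \in s by rewrite mem_next.
  have := mate_prev nxs; have := mate_prev xs; have := next_alt xs.
  have := next_alt nxs; rewrite a_next // prev_next //.
  case: (a x) => /= nn n1 pr1 prn; first by rewrite -n1 nn.
  by rewrite pr1 next_prev // prn.
exists q => //; rewrite qo odd_next_perm // alt_even_size /=; congr (~~ _).
rewrite odd_card_xor.
pose G x := D x (f x) && ~~ D (next s x) (f' (next s x)).
transitivity (\big[addb/false]_(x in s) G x).
  rewrite [RHS]big_mkcond; apply: eq_bigr => x _; rewrite inE !permE.
  case: ifP => // /negbT xs; rewrite next_out // off_s //.
  by case: (D _ _).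
(* Let [a x], [y = next s x] and [z = next s y]. Rotation carries the [f]-edge [xy] to the [f']-edge
   [yz], and reverses it exactly when one of [D x y], [D y z] holds and the other fails. *)
rewrite xor_pairs [RHS]xor_pairs; apply: eq_bigr => x xs.
have [ax|//] := boolP (a x) => /=; rewrite /G.
have nxs : next s x \in s by rewrite mem_next.
have nnxs : next s (next s x) \in s by rewrite mem_next.
have := next_alt nxs; have := next_alt xs; have := mate_prev nnxs.
rewrite !a_next // ax /= prev_next // => f'z fx f'y.
have fy : f (next s x) = x by rewrite fx fK.
have Dyx : D (next s x) x = ~~ D x (next s x) by rewrite fx fD.
have Dzy : D (next s (next s x)) (next s x)
    = ~~ D (next s x) (next s (next s x)).
  by rewrite f'y f'D.
rewrite f'z fy -f'y -fx Dyx Dzy.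
by case: (D x _); case: (D (next s x) _).
Qed.

End Next.
End Sign.

(** * Alternating cycles in the union of two 1-factors *)

Section Component.
Variables (T : finType) (f f' : T -> T).
Hypotheses (fK : involutive f) (f'K : involutive f').
Hypotheses (f_neq : forall x, f x != x) (f'_neq : forall x, f' x != x).

(* In a state (x, b) the boolean tells which of f and f' is applied next. *)
Let step (u : T * bool) := (if u.2 then f u.1 else f' u.1, ~~ u.2).

Lemma step_inj : injective step.
Proof.
by move=> [x []] [y []] //= [] => [/(inv_inj fK)|/(inv_inj f'K)] ->.
Qed.

(* The alternating walk from x cannot come back to x along the edge by which
   it should leave next: peeling one step off both ends shortens it. *)
Lemma iter_step_neq n x b : iter n step (x, b) != (x, ~~ b).
Proof.
elim/ltn_ind: n x b => -[|[|n]] IHn x b.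
- by rewrite xpair_eqE eqxx; case: b.
- by case: b; rewrite xpair_eqE ?(negbTE (f_neq x)) ?(negbTE (f'_neq x)).
have := IHn n (leqW (leqnn _)) (step (x, b)).1 (~~ b); apply: contra.
have -> : (x, ~~ b) = step ((step (x, b)).1, b).
  by case: b; rewrite /step /= ?fK ?f'K.
by rewrite iterS (inj_eq step_inj) iterSr negbK.
Qed.

(** The cycle is the orbit of the state [(x0, true)] with the booleans forgotten. By [iter_step_neq]
    no vertex is reached in both states, so the next vertex is a function of the vertex alone. *)
Lemma alternating_component x0 : f x0 != f' x0 ->
  exists s (a : pred T),
    [/\ uniq s, 2 < size s, x0 \in s,
        {in s, forall x, a (next s x) = ~~ a x} &
        {in s, forall x, next s x = if a x then f x else f' x}].
Proof.
move=> nx0; pose reach := fconnect step (x0, true).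
pose a x := reach (x, true); pose c x := reach (x, false).
have ca x : c (f x) = a x.
  by rewrite /a /reach (same_fconnect1_r step_inj).
have ac x : a (f' x) = c x.
  by rewrite /c /reach (same_fconnect1_r step_inj).
have aNc x : a x -> c x = false.
  rewrite /a /reach (fconnect_sym step_inj) => xa; apply/negP => xc.
  have := connect_trans xa xc => /iter_findex E.
  have := iter_step_neq (findex step (x, true) (x, false)) x true.
  by rewrite E eqxx.
have cNa x : c x -> a x = false by move=> cx; apply/negP => /aNc; rewrite cx.
(* Being the identity off the walk makes [h] injective on all of [T], so that its orbits are
   cycles. *)
pose h x := if a x then f x else if c x then f' x else x.
have h_a x : a x -> c (h x) by rewrite /h => ax; rewrite ax ca.
have h_c x : c x -> a (h x) by rewrite /h => cx; rewrite (cNa x) // cx ac.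
have h_n x : ~~ a x -> ~~ c x -> h x = x.
  by rewrite /h => /negbTE-> /negbTE->.
have h_inj : injective h.
  have cls x : a (h x) = c x /\ c (h x) = a x.
    have [ax|ax] := boolP (a x).
      by rewrite h_a // (aNc x) //; split=> //; apply/negP => /aNc; rewrite h_a.
    have [cx|cx] := boolP (c x).
      by rewrite h_c //; split=> //; apply: aNc; apply: h_c.
    by rewrite h_n // (negbTE ax) (negbTE cx).
  move=> x y E; have [ax cx] := cls x; have [ay cy] := cls y.
  move: E ax cx; rewrite {1}/h {1}/h => E; rewrite -[h x]/(h x) => ax cx.
  have : c x = c y by rewrite -ax -ay /h E.
  have : a x = a y by rewrite -cx -cy /h E.
  by move: E => /[swap] -> /[swap] ->; case: (a y) => [/(inv_inj fK)|] //;
    case: (c y) => [/(inv_inj f'K)|].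
pose s := fingraph.orbit h x0.
have a0 : a x0 by apply: connect0.
have s_ac x : x \in s -> a x || c x.
  rewrite -fconnect_orbit => /iter_findex <-.
  elim: (findex _ _ _) => [|n]; first by rewrite /= a0.
  by rewrite iterS => /orP[/h_a|/h_c] ->; rewrite ?orbT.
have nh x : x \in s -> next s x = h x.
  by move=> xs; apply/esym/eqP; apply: (next_cycle (cycle_orbit h_inj x0) xs).
have x0s : x0 \in s by rewrite -fconnect_orbit.
exists s, a; split=> // [||x xs|x xs].
- exact: orbit_uniq.
- have h0 : h x0 = f x0 by rewrite /h a0.
  have h1 : h (f x0) = f' (f x0).
    rewrite -h0 /h; move: (h_a _ a0); rewrite /h a0 => cx.
    by rewrite (cNa (f x0)) // cx.
  (* The third vertex differs from [x0] because [f] and [f'] disagree at [x0]. *)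
  have U : uniq [:: x0; f x0; f' (f x0)].
    rewrite /= !inE negb_or andbT -!(eq_sym (f' _)) f'_neq andbT.
    by rewrite eq_sym f_neq (can2_eq f'K f'K).
  apply: (uniq_leq_size U) => y; rewrite !inE -fconnect_orbit.
  case/or3P=> /eqP->; first exact: connect0.
    by rewrite -h0; apply: fconnect1.
  by rewrite -h1 -h0; apply: (fconnect_iter _ 2).
- rewrite nh //; case/orP: (s_ac x xs) => [ax|cx].
    by rewrite ax; apply/negP => /aNc; rewrite h_a.
  by rewrite h_c // cNa.
rewrite nh // /h; case/orP: (s_ac x xs) => [->|cx] //.
by rewrite cNa // cx.
Qed.

End Component.

(** * 1-factors as involutions, and the equality of their signs *)

Section Mates.
Variables (T : finType) (e : rel T).
Hypotheses (e_sym : symmetric e) (e_irr : irreflexive e).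
Implicit Types (f : T -> T) (s : seq T) (C F : {set {set T}}) (D : rel T).

Definition mate f := involutive f /\ forall x, e x (f x).
Definition matching f : {set {set T}} := [set [set x; f x] | x in T].

Lemma mate_neq f x : mate f -> f x != x.
Proof. by case=> _ /(_ x); apply: contraTneq => ->; rewrite e_irr. Qed.

Lemma mate_oriented D f : orientation e D -> mate f -> oriented_along D f.
Proof.
by move=> oD [fK fe] x; rewrite (orientation_flip oD) // e_sym.
Qed.

Lemma mem_matching f x y : mate f -> ([set x; y] \in matching f) = (y == f x).
Proof.
move=> [fK _]; apply/imsetP/eqP => [[z _ /set2_eq[][-> ->]]|->] //.
by exists x.
Qed.

Lemma one_factor_mate F : one_factor e F -> exists2 f, mate f & F = matching f.
Proof.
case/andP=> /subsetP Fe /forallP F1.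
have Fsub x y : [set x; y] \in F -> e x y.
  move/Fe/imset2P => [u v _]; rewrite inE => /andP[_ uv].
  by case/set2_eq => [] [-> ->] //; rewrite e_sym.
have Fex x : exists y, [set x; y] \in F.
  have /cards1P[g /setP/(_ g)] := F1 x; rewrite !inE eqxx => /andP[gF xg].
  have /imset2P[u v _ _ gE] := Fe _ gF; move: xg gF; rewrite gE !inE.
  by case/orP => /eqP-> gF; [exists v | exists u; rewrite setUC].
have Funi x y z : [set x; y] \in F -> [set x; z] \in F -> y = z.
  move=> xy xz; have /cards1P[g /setP gE] := F1 x.
  have := gE [set x; y]; have := gE [set x; z].
  rewrite !inE xy xz !eqxx /= => /esym/eqP Ez /esym/eqP.
  by rewrite -Ez => /set2_eq[[]|[-> ->]].
(* [Fex] always provides a partner, so the default is never returned. *)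
pose f x := odflt x [pick y | [set x; y] \in F].
have fF x : [set x; f x] \in F.
  rewrite /f; case: pickP => [y //|no]; have [y] := Fex x.
  by rewrite no.
exists f.
  split=> x; last exact: Fsub.
  by apply: (Funi (f x)); rewrite ?fF // setUC.
apply/setP => g; apply/idP/imsetP => [gF|[x _ ->] //].
have /imset2P[u v _ _ gE] := Fe _ gF; exists u => //.
rewrite gE; congr (_ |: [set _]).
by apply: (Funi u); rewrite -?gE ?fF.
Qed.

(** Two consecutive edges of a cycle are never both in the matching. Summing this bound over all
    consecutive pairs gives at most [#|C|], with equality exactly when every pair contains one
    matching edge. *)
Lemma matching_alternating f s C : mate f -> traverses e s C ->
  alternating e (matching f) C =
  [forall (x | x \in s),
    (next s (next s x) == f (next s x)) == (next s x != f x)].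
Proof.
move=> mf tr; rewrite /alternating (trav_is_cycle tr) /=.
have Us := trav_uniq tr; have s2 := trav_size tr.
pose b x : nat := next s x == f x.
have FC : #|matching f :&: C| = \sum_(x in s) b x.
  rewrite -sum1_card (eq_bigl (fun c => (c \in C) && (c \in matching f))).
    rewrite big_mkcondr (trav_edges tr) big_imset /=.
      by apply: eq_bigr => x _; rewrite mem_matching.
    exact: next_edge_inj.
  by move=> c; rewrite inE andbC.
have FC' : #|matching f :&: C| = \sum_(x in s) b (next s x).
  rewrite FC (reindex_inj (can_inj (prev_next Us))).
  by apply: eq_bigl => x; rewrite mem_next.
have CE : #|C| = \sum_(x in s) 1.
  by rewrite sum1_card (trav_card tr); apply/esym/card_uniqP.
rewrite mul2n -addnn {1}FC FC' CE -big_split /= eq_sym.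
suff le1 x : x \in s -> b x + b (next s x) <= 1
    ?= iff ((next s (next s x) == f (next s x)) == (next s x != f x)).
  by have [_ ->] := leqif_sum le1.
move=> xs; rewrite /b.
have nb : (next s x == f x) && (next s (next s x) == f (next s x)) = false.
  apply/negP => /andP[/eqP E /eqP E2]; have := next_next_neq Us s2 xs.
  by rewrite E2 E (proj1 mf) eqxx.
by move: nb; do 2![case: (_ == _)].
Qed.

Lemma trav_traverses s : uniq s -> 2 < size s ->
  {in s, forall x, e x (next s x)} -> traverses e s (traversal_edges s).
Proof.
move=> Us s2 se; rewrite /traverses s2 eqxx andbT /ucycleb Us andbT.
exact: cycle_from_next.
Qed.

(* Replacing the edges of f along an alternating cycle by the other edges of
   the cycle changes the sign if and only if the cycle is evenly oriented. *)
Lemma carries_cycle D f f' s C (a : pred T) : orientation e D ->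
  mate f -> mate f' -> traverses e s C ->
  {in s, forall x, a (next s x) = ~~ a x} ->
  {in s, forall x, next s x = if a x then f x else f' x} ->
  (forall x, x \notin s -> f x = f' x) ->
  exists2 q, carries D f f' q & odd_perm q = ~~ oddly_oriented e D C.
Proof.
move=> oD mf mf' tr aN nE off.
have Us := trav_uniq tr.
have [fD f'D] := (mate_oriented oD mf, mate_oriented oD mf').
have s0 : s != [::] by have := trav_size tr; case: (s).
have [q cq qo] :=
  carries_rotation Us aN (proj1 mf) (proj1 mf') fD f'D nE off s0.
exists q => //; rewrite qo (oddly_orientedE oD _ tr) ?(odd_forward tr) //.
by rewrite (trav_card tr); apply: (alt_even_size Us aN).
Qed.

(** Induction on the number of vertices where [f] and [f'] disagree. A cycle of their union
    alternates for [f], hence is oddly oriented; switching [f'] to [f] along it gives [f1], closer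
    to [f] and of the same sign as [f']. *)
Lemma odd_same_sign D f f' : orientation e D -> mate f ->
  (forall C, alternating e (matching f) C -> oddly_oriented e D C) ->
  mate f' -> exists2 q, carries D f f' q & odd_perm q = false.
Proof.
move=> oD mf oddf; have [n] := ubnP #|[set x | f x != f' x]|.
elim: n f' => // n IHn f' /ltnSE le mf'.
have [/cards0_eq/setP E|] := posnP #|[set x | f x != f' x]|.
  exists 1%g; last exact: odd_perm1.
  have E' x : f x = f' x by have := E x; rewrite !inE => /negbFE/eqP.
  by split=> x; rewrite !perm1 E'.
case/card_gt0P => x0; rewrite inE => x0P.
have fn x := mate_neq x mf; have f'n x := mate_neq x mf'.
have [s [a [Us s2 x0s aN nE]]] :=
  alternating_component (proj1 mf) (proj1 mf') fn f'n x0P.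
have tr : traverses e s (traversal_edges s).
  apply: trav_traverses => // x xs; rewrite nE //.
  by case: (a x); [apply: (proj2 mf) | apply: (proj2 mf')].
have altC : alternating e (matching f) (traversal_edges s).
  rewrite (matching_alternating mf tr); apply/forall_inP => x xs.
  have nf := next_altE Us aN (proj1 mf) (proj1 mf') nE s2.
  by rewrite !nf ?mem_next // aN.
pose f1 x := if x \in s then f x else f' x.
have s_closed x : x \in s -> f x \in s.
  move=> xs; have := mate_prev Us aN (proj1 mf) (proj1 mf') nE xs.
  have := nE _ xs.
  by case: (a x) => [<- _|_ ->]; rewrite ?mem_next ?mem_prev.
have s_closed' x : x \notin s -> f' x \notin s.
  apply: contra => xs; rewrite -(proj1 mf' x).
  have := mate_prev Us aN (proj1 mf) (proj1 mf') nE xs.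
  have := nE _ xs.
  by case: (a _) => [_ ->|<- _]; rewrite ?mem_next ?mem_prev.
have mf1 : mate f1.
  split=> x; rewrite /f1; have [xs|xs] := boolP (x \in s).
  - by rewrite s_closed // (proj1 mf).
  - by rewrite (negbTE (s_closed' _ xs)) (proj1 mf').
  - exact: (proj2 mf).
  - exact: (proj2 mf').
have [||q1 cq1 q1o] := IHn f1 => //.
  apply: leq_trans le; apply/proper_card/properP; split.
    by apply/subsetP => x; rewrite !inE /f1; case: ifP => //; rewrite eqxx.
  by exists x0; rewrite !inE // /f1 x0s eqxx.
have [||q2 cq2 q2o] := @carries_cycle D f1 f' s _ a oD mf1 mf' tr aN.
- by move=> x xs; rewrite nE // /f1 xs.
- by move=> x xs; rewrite /f1 (negbTE xs).
exists (q1 * q2)%g; first exact: carriesM cq1 cq2.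
by rewrite odd_permM q1o q2o oddf.
Qed.

(* An odd F-orientation gives all 1-factors the same sign, and F' and its
   symmetric difference with an F'-alternating cycle C have the same sign only
   if C is oddly oriented. *)
Lemma odd_orientation_all D f f' : orientation e D -> mate f -> mate f' ->
  (forall C, alternating e (matching f) C -> oddly_oriented e D C) ->
  forall C, alternating e (matching f') C -> oddly_oriented e D C.
Proof.
move=> oD mf mf' oddf C altC; have [_ [s tr]] := alternating_even altC.
have Us := trav_uniq tr.
pose a x := next s x == f' x.
have aN : {in s, forall x, a (next s x) = ~~ a x}.
  move=> x xs; move: altC; rewrite (matching_alternating mf' tr).
  by move/forall_inP/(_ x xs)/eqP.
(* [g] is the mate function of the symmetric difference of the second 1-factor and [C]: on [s] it
   takes the neighbour on the other side from [f' x]. *)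
pose g x := if x \in s then if a x then prev s x else next s x else f' x.
have f'prev x : x \in s -> ~~ a x -> f' x = prev s x.
  move=> xs ax; have pxs : prev s x \in s by rewrite mem_prev.
  have := aN _ pxs; rewrite next_prev // (negbTE ax) => /esym/negbFE.
  by rewrite /a next_prev // => /eqP {1}->; rewrite (proj1 mf').
have s_closed x : x \in s -> f' x \in s.
  move=> xs; have [/eqP<-|ax] := boolP (a x); first by rewrite mem_next.
  by rewrite f'prev // mem_prev.
have mg : mate g.
  split=> x; rewrite /g; have [xs|xs] := boolP (x \in s).
  - have pxs : prev s x \in s by rewrite mem_prev.
    have := aN _ pxs; rewrite next_prev //; have := aN _ xs.
    case: (a x) => anx apx; rewrite ?mem_prev ?mem_next xs.
      by move/esym/negbTE: apx => ->; rewrite next_prev.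
    by rewrite anx prev_next.
  - have f'xs : f' x \notin s.
      by apply: contra xs => /s_closed; rewrite (proj1 mf').
    by rewrite (negbTE f'xs) (proj1 mf').
  - case: (a x); last exact: (trav_edge tr).
    rewrite e_sym; have pxs : prev s x \in s by rewrite mem_prev.
    by have := trav_edge tr pxs; rewrite next_prev.
  - exact: (proj2 mf').
have [||q cq qo] := @carries_cycle D f' g s C a oD mf' mg tr aN.
- by move=> x xs; rewrite /g xs; case ax: (a x) => //; apply/eqP.
- by move=> x xs; rewrite /g (negbTE xs).
have [p cp po] := odd_same_sign oD mf oddf mf'.
have [r cr ro] := odd_same_sign oD mf oddf mg.
(* Both [p * q] and [r] carry [f] to [g]; as [p] and [r] are even, so is [q]. *)
have := carries_parity (proj1 mf) (mate_oriented oD mf) (carriesM cp cq) cr.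
by rewrite odd_permM po ro qo => /negbFE.
Qed.

End Mates.

(** * Reversing edges, and the equivalence *)

Section Main.
Variables (T : finType) (e : rel T).
Hypotheses (e_sym : symmetric e) (e_irr : irreflexive e).

Lemma orientation_exists : exists D, orientation e D.
Proof.
exists [rel x y | e x y && (enum_rank x < enum_rank y)].
split=> [x y /andP[]//|x y exy] /=; rewrite exy e_sym exy /=.
have: enum_rank x != enum_rank y.
  by apply: contraTneq exy => /enum_rank_inj->; rewrite e_irr.
by rewrite -val_eqE /=; case: ltngtP.
Qed.

Lemma orientation_reverse D (Z : {set {set T}}) : orientation e D ->
  exists2 D', orientation e D' &
    forall x y, e x y -> D x y (+) D' x y = ([set x; y] \in Z).
Proof.
move=> [De Dx]; exists [rel x y | e x y && (D x y (+) ([set x; y] \in Z))].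
  split=> [x y /andP[]//|x y exy] /=; rewrite exy e_sym exy /=.
  rewrite [[set y; x]]setUC; move: (Dx _ _ exy).
  by case: (D x y); case: (D y x); case: ([set x; y] \in Z).
by move=> x y exy /=; rewrite exy /= addKb.
Qed.

Lemma orientations_differ D D' : orientation e D -> orientation e D' ->
  exists2 Z : {set {set T}}, Z \subset edges e &
    forall x y, e x y -> D x y (+) D' x y = ([set x; y] \in Z).
Proof.
move=> oD oD'.
exists [set [set x; y] | x in T, y in T & e x y && (D x y (+) D' x y)].
  apply/subsetP => g /imset2P[x y _]; rewrite inE => /and3P[_ exy _] ->.
  by apply/imset2P; exists x y; rewrite ?inE.
move=> x y exy; apply/idP/imset2P => [Dxy|[u v _]].
  by exists x y; rewrite ?inE // exy.
rewrite inE => /and3P[_ euv Duv] /set2_eq[][-> ->] //.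
have evu : e v u by rewrite e_sym.
by rewrite (orientation_flip oD evu) (orientation_flip oD' evu) addbN addNb negbK.
Qed.

(** Incidences between [Z] and the members of [A] are counted in two ways; each edge of [Z]
    contributes an even number. *)
Lemma double_count_parity (A : {set {set {set T}}}) (Z : {set {set T}}) :
  (forall f, f \in Z -> ~~ odd #|[set C in A | f \in C]|) ->
  ~~ odd #|[set C in A | odd #|[set f in Z | f \in C]|]|.
Proof.
move=> evA; rewrite odd_card_set_xor.
under eq_bigr => C _ do rewrite odd_card_set_xor.
rewrite exchange_big big1 // => f fZ /=.
by rewrite -odd_card_set_xor; apply/negbTE/evA.
Qed.

(** Let [Z] be the set of edges where the two orientations differ. All members of [A] are odd for
    [D'], so those even for [D] are the ones meeting [Z] oddly, and there are evenly many of
    these. *)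
Lemma bad_not_pfaffian : bad e -> ~ pfaffian e.
Proof.
move=> [F [A [D [F1 [altA evA] oD oddA _]]]] [D' [oD' /(_ F F1)[_ oddF]]].
have [Z /subsetP Ze dZ] := orientations_differ oD oD'.
have := @double_count_parity A Z (fun f fZ => evA f (Ze f fZ)).
suff -> : [set C in A | odd #|[set f in Z | f \in C]|]
    = [set C in A | evenly_oriented e D C] by rewrite oddA.
apply/setP => C; rewrite !inE; have [CA|//] := boolP (C \in A).
have aC := altA _ CA; rewrite -(oriented_diff dZ oD oD' aC) /=.
have := oddF _ aC; rewrite (parity_oriented oD' aC) => /negbTE->.
by rewrite addbF.
Qed.

Lemma not_pfaffian_bad : ~ pfaffian e -> bad e.
Proof.
move=> nP; have [D oD] := orientation_exists.
have [/existsP[F F1]|/existsPn no] := boolP [exists F, one_factor e F];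
    last first.
  (* Without 1-factors, every orientation is vacuously Pfaffian. *)
  by case: nP; exists D; split=> // F F1; have := no F; rewrite F1.
have [f mf FE] := one_factor_mate e_sym F1.
(* There is one equation for every [C]; the conjunct [alternating e F C] on both sides reduces it to
   0 = 0 unless [C] is an alternating cycle. *)
have [[Z HZ]|[A [evA oddA]]] := @F2_alternative _ _
    (fun c (C : {set {set T}}) => alternating e F C && (c \in C))
    (fun C => alternating e F C && evenly_oriented e D C); last first.
  exists F, [set C in A | alternating e F C], D; split=> //.
  - split=> [C|c _]; first by rewrite inE => /andP[].
    move: (evA c); congr (~~ odd #|pred_of_set _|).
    by apply/setP => C; rewrite !inE andbA.
  - move: oddA; congr (odd #|pred_of_set _|).
    by apply/setP => C; rewrite !inE andbA.
  by move=> C; rewrite inE => /andP[_ /(parity_oriented oD) ->].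
case: nP; have [D' oD' dZ] := orientation_reverse Z oD.
exists D'; split=> // F' /(one_factor_mate e_sym)[f' mf' ->]; split=> //.
apply: (odd_orientation_all e_sym e_irr oD' mf mf'); rewrite -FE => C aC.
rewrite (parity_oriented oD' aC); apply/negP => ev.
have := oriented_diff dZ oD oD' aC; have := HZ C; rewrite aC ev /= => ->.
by case: (evenly_oriented e D C).
Qed.

End Main.

Theorem theorem4p3 (T : finType) (e : rel T)
  (e_sym : symmetric e) (e_irr : irreflexive e) :
  bad e <-> ~ pfaffian e.
Proof.
by split; [apply: bad_not_pfaffian | apply: not_pfaffian_bad].
Qed.
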